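(* Let $A,B,C,D\in\mathbb{C}^{n\times n}$ be group invertible matrices, and let $K=D-CA^{\#}B$ and $L=A-BD^{\#}C$. Suppose that $L=0$. If $K=0$, then $(I-CC^\#)D=0$, $D(I-B^\# B)=0$ and $C^\# D B^\# \in (BD^\# C)\{1,2\}$.
   Context: A square matrix $X$ is group invertible if there is a matrix $Y$ with $XYX=X$, $YXY=Y$ and $XY=YX$; such a $Y$ is unique, is called the group inverse of $X$, and is denoted $X^{\#}$. For a matrix $X$, $X\{1,2\}$ denotes the set of all matrices $Y$ with $XYX=X$ and $YXY=Y$. $I$ is the $n\times n$ identity matrix. *)

(* Defs.v *)
From mathcomp Require Import all_boot all_order all_algebra.
From mathcomp Require Import all_classical all_reals.
From mathcomp Require Export complex.

Set Implicit Arguments.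
Unset Strict Implicit.
Unset Printing Implicit Defensive.

Import GRing.Theory.
Local Open Scope classical_set_scope.
Local Open Scope ring_scope.

Definition is_group_inverse (F : pzRingType) (n : nat) (X Y : 'M[F]_n) : Prop :=
  [/\ X *m Y *m X = X, Y *m X *m Y = Y & X *m Y = Y *m X].

Definition group_invertible (F : pzRingType) (n : nat) (X : 'M[F]_n) : Prop :=
  exists Y : 'M[F]_n, is_group_inverse X Y.

(* A total function: the value 0 is junk when X is not group invertible. *)
Definition group_inverse (F : pzRingType) (n : nat) (X : 'M[F]_n) : 'M[F]_n :=
  xget 0 [set Y | is_group_inverse X Y].

(* Same symbol as the group_scope notation for a set minus the identity. *)
Notation "X ^#" := (group_inverse X) : ring_scope.

Definition inverses12 (F : pzRingType) (m n : nat) (X : 'M[F]_(m, n)) :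
    set 'M[F]_(n, m) :=
  [set Y | X *m Y *m X = X /\ Y *m X *m Y = Y].

Lemma is_group_inverse_uniq (F : pzRingType) (n : nat) (X Y Z : 'M[F]_n) :
  is_group_inverse X Y -> is_group_inverse X Z -> Y = Z.
Proof.
move=> [XYX YXY XY] [XZX ZXZ XZ].
have XYXZ : X *m Y = X *m Z.
  by rewrite -[in LHS]XZX -mulmxA XZ XY mulmxA -2!mulmxA (mulmxA X Y) XYX.
by rewrite -YXY -mulmxA XYXZ mulmxA -XY XYXZ XZ ZXZ.
Qed.

Lemma group_inverseP (F : pzRingType) (n : nat) (X : 'M[F]_n) :
  group_invertible X -> is_group_inverse X X^#.
Proof. exact: xgetPex. Qed.

Lemma group_inverseE (F : pzRingType) (n : nat) (X Y : 'M[F]_n) :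
  is_group_inverse X Y -> X^# = Y.
Proof.
by move=> XY; apply: xget_unique => // Z XZ; apply: is_group_inverse_uniq XZ XY.
Qed.

(* Main.v *)
Require Import Defs.
From mathcomp Require Import all_boot all_order all_algebra.
From mathcomp Require Import all_classical all_reals.
Local Open Scope classical_set_scope.
Local Open Scope ring_scope.

(** [K = 0] says [D = C A^# B], so the idempotents [C C^#] and [B^# B], which satisfy [C C^# C = C]
    and [B B^# B = B], fix [D] from the left and from the right. Absorbing them into [D] reduces the
    two {1,2}-inverse equations to [D^# D D^# = D^#] and [D D^# D = D]. *)

Theorem theorem3p5 (R : realType) (n : nat) (A B C D : 'M[R[i]]_n)
  (hA : group_invertible A) (hB : group_invertible B)
  (hC : group_invertible C) (hD : group_invertible D) :
  let K := D - C *m A^# *m B in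
  let L := A - B *m D^# *m C in
  L = 0 -> K = 0 ->
  [/\ (1%:M - C *m C^#) *m D = 0,
      D *m (1%:M - B^# *m B) = 0 &
      C^# *m D *m B^# \in inverses12 (B *m D^# *m C)].
Proof.
move=> K L _ /GRing.subr0_eq DE.
have [BBB _ _] := group_inverseP hB.
have [CCC _ _] := group_inverseP hC.
have [DDD DDD' _] := group_inverseP hD.
have CD : C *m C^# *m D = D by rewrite DE !mulmxA CCC.
have DB : D *m B^# *m B = D by rewrite DE -!mulmxA (mulmxA B) BBB.
split.
- by rewrite mulmxBl mul1mx CD GRing.subrr.
- by rewrite mulmxBr mulmx1 mulmxA DB GRing.subrr.
apply/mem_set; split.
(* The bracketed middle collapses to [D], leaving [B D^# D D^# C]. *)
- transitivity (B *m D^# *m (C *m C^# *m D *m B^# *m B) *m D^# *m C).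
    by rewrite !mulmxA.
  by rewrite CD DB -(mulmxA B) -(mulmxA B) DDD'.
(* Each bracket collapses to [D], leaving [C^# D D^# D B^#]. *)
- transitivity (C^# *m (D *m B^# *m B) *m D^# *m (C *m C^# *m D) *m B^#).
    by rewrite !mulmxA.
  by rewrite CD DB -(mulmxA C^#) -(mulmxA C^#) DDD.
Qed.
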